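(* Let $n,m\ge 1$. The number of plane labelled bipartite trees with $n$ white vertices and $m$ black vertices equals $$\frac{\bigl((n+m-2)!\bigr)^2}{(n-1)!\,(m-1)!}.$$
   Context: A plane tree is a finite tree embedded in the oriented plane. Two such trees are identified if an orientation-preserving homeomorphism of the plane carries one onto the other; equivalently, a plane tree is a tree together with a cyclic order of the edges at each vertex. A bipartite tree is a tree whose vertices are colored black and white so that adjacent vertices have different colors. A plane labelled bipartite tree with $n$ white and $m$ black vertices is a plane bipartite tree in which the white vertices carry the distinct labels $v_1,\dots,v_n$ and the black vertices carry the distinct labels $u_1,\dots,u_m$ (each label used exactly once). Two such labelled trees are identified if an orientation-preserving homeomorphism of the plane maps one onto the other, preserving colors and labels. Such a tree has $n+m-1$ edges. *)

(* Defs.v *)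
From mathcomp Require Import all_boot all_fingroup.
Set Implicit Arguments. Unset Strict Implicit. Unset Printing Implicit Defensive.

(* Vertices: white v_i = inl i (i : 'I_n), black u_j = inr j (j : 'I_m).
   Since a bipartite tree only has white-black edges and no multiple edges,
   an edge is a pair (i, j) : 'I_n * 'I_m, and the edge set is E : {set 'I_n * 'I_m}. *)

Definition btree_adj (n m : nat) (E : {set 'I_n * 'I_m}) : rel ('I_n + 'I_m) :=
  fun x y => match x, y with
             | inl i, inr j => (i, j) \in E
             | inr j, inl i => (i, j) \in E
             | _, _ => false
             end.

Definition is_btree (n m : nat) (E : {set 'I_n * 'I_m}) : bool :=
  [forall x, forall y, connect (btree_adj E) x y] && (#|E| == (n + m).-1).

(* s : a permutation of the edges (darts of one colour) that is a cyclic order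
   of the edges around each vertex of colour given by [side]:
   - s fixes the non-edges, maps edges to edges at the same vertex,
   - for each vertex, the edges at it form a single cycle of s. *)
Definition is_rotation (n m : nat) (T : finType) (side : 'I_n * 'I_m -> T)
  (E : {set 'I_n * 'I_m}) (s : {perm 'I_n * 'I_m}) : bool :=
  [forall e, (e \notin E) ==> (s e == e)] &&
  [forall e, (e \in E) ==> ((s e \in E) && (side (s e) == side e))] &&
  [forall e, forall e', [&& e \in E, e' \in E & side e == side e'] ==>
                        fconnect s e e'].

Definition plane_lbtree (n m : nat)
  (t : {set 'I_n * 'I_m} * {perm 'I_n * 'I_m} * {perm 'I_n * 'I_m}) : bool :=
  let: (E, sw, sb) := t in
  [&& is_btree E, is_rotation (fun e => e.1) E sw & is_rotation (fun e => e.2) E sb].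

(* Main.v *)
Require Import Defs.
From mathcomp Require Import all_boot all_fingroup.
From mathcomp Require Import zify.
Set Implicit Arguments. Unset Strict Implicit. Unset Printing Implicit Defensive.

(* The number of plane structures on a tree is the product of [(deg v - 1)!]
    over its vertices [v]. Prescribe a degree [d v >= 1] for every vertex of a
    tree with [k] vertices of one colour and [l] of the other. Some [d x] is 1,
    say with [x] among the [k]; deleting the leaf [x], attached to [y], lowers
    [d y] by one and divides the product by [d y - 1]. Since the numbers
    [d y - 1] over the colour opposite to [x] add up to [k - 1], induction shows
    that the plane trees with degrees [d] number [(k - 1)! (l - 1)!], whatever
    [d] is. The degree sequences are counted as pairs of compositions. *)

Lemma bin_fact_add p q : 'C(p + q, p) * (p`! * q`!) = (p + q)`!.
Proof. by rewrite -(bin_fact (leq_addr q p)) addKn. Qed.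

Lemma big_bool_negb R (idx : R) (op : Monoid.com_law idx) (F : bool -> R) b :
  \big[op/idx]_(c : bool) F c = op (F b) (F (~~ b)).
Proof. by rewrite big_bool; case: b; rewrite // Monoid.mulmC. Qed.

Lemma connect_retract (T : finType) (r s : rel T) (h : T -> T) :
    connect_sym r -> subrel s (connect r) -> (forall x, connect r x (h x)) ->
    {homo h : x y / r x y >-> connect s x y} ->
  forall x y, connect r x y = connect s (h x) (h y).
Proof.
move=> r_sym sub_sr r_h h_step x y; apply/idP/idP => [/connectP[p + ->]|s_hxy].
  elim: p x => [|z p IHp] x /=; first by rewrite connect0.
  by case/andP=> /h_step s_xz /IHp; apply: connect_trans s_xz.
apply: connect_trans (r_h x) _; rewrite r_sym; apply: connect_trans (r_h y) _.
by rewrite r_sym; apply: connect_sub s_hxy.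
Qed.

Definition contract (T : eqType) (x y z : T) := if z == x then y else z.

Lemma contractL (T : eqType) (x y : T) : contract x y x = y.
Proof. by rewrite /contract eqxx. Qed.

Lemma contract_neq (T : eqType) (x y z : T) : z != x -> contract x y z = z.
Proof. by rewrite /contract => /negPf ->. Qed.

Section Rotations.
Variables (T U : finType) (f : T -> U).
Implicit Types (x y z : T) (A : {set T}) (s : {perm T}).

Definition fiber A u := [set x in A | f x == u].

Definition same_fiber A x y := (x == y) || [&& x \in A, y \in A & f x == f y].

Definition rotations A : {set {perm T}} :=
  [set s : {perm T} | [forall x, forall y, fconnect s x y == same_fiber A x y]].

Lemma rotationsP A s :
  reflect (fconnect s =2 same_fiber A) (s \in rotations A).
Proof. by rewrite inE; apply: (iffP 'forall_'forall_eqP). Qed.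

Lemma same_fiberC A : symmetric (same_fiber A).
Proof. by move=> x y; rewrite /same_fiber eq_sym andbCA [f x == _]eq_sym. Qed.

Lemma same_fiber_notin A x y : x \notin A -> same_fiber A x y = (x == y).
Proof. by move=> /negPf Ax; rewrite /same_fiber Ax orbF. Qed.

Lemma same_fiber_setU1 A x y z :
  y != x -> z != x -> same_fiber (x |: A) y z = same_fiber A y z.
Proof. by move=> /negPf yx /negPf zx; rewrite /same_fiber !inE yx zx. Qed.

Lemma same_fiber_setU1l A x y :
  y != x -> same_fiber (x |: A) x y = (y \in fiber A (f x)).
Proof.
by move=> /negPf yx; rewrite /same_fiber !inE eqxx eq_sym yx [f x == _]eq_sym.
Qed.

Lemma fconnect_fixed (g : T -> T) x : g x = x -> fconnect g x =1 pred1 x.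
Proof.
move=> gx y; apply/idP/eqP => [/iter_findex <-|->]; last exact: connect0.
by elim: (findex _ _ _) => //= k ->.
Qed.

(* [tperm y x * s] inserts the fixed point [x] of [s] right after [y] in the
   cycle of [y]. *)
Lemma fconnect_insert s x y : s x = x -> y != x ->
  forall z t,
    fconnect (tperm y x * s)%g z t =
    fconnect s (contract x y z) (contract x y t).
Proof.
move=> sx yx; set r := (tperm y x * s)%g.
have ry : r y = x by rewrite permM tpermL.
have rx : r x = s y by rewrite permM tpermR.
have rD z : z != x -> z != y -> r z = s z.
  by move=> zx zy; rewrite permM tpermD // eq_sym.
have contract_s z : z != x -> contract x y (s z) = s z.
  by move=> zx; rewrite contract_neq // -[X in _ != X]sx (inj_eq perm_inj).
apply: connect_retract => [z t|z _ /eqP<-|z|z _ /eqP<-].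
- exact/fconnect_sym/perm_inj.
- have [-> | zx] := eqVneq z x; first by rewrite sx connect0.
  have [-> | zy] := eqVneq z y; last by rewrite -rD // fconnect1.
  by apply: connect_trans (fconnect1 _ _) _; rewrite ry -rx fconnect1.
- have [-> | zx] := eqVneq z x; last by rewrite contract_neq.
  rewrite contractL (fconnect_sym perm_inj).
  by rewrite -[X in fconnect _ _ X]ry fconnect1.
- have [-> | zx] := eqVneq z x.
    by rewrite rx contract_s ?contractL ?fconnect1.
  have [-> | zy] := eqVneq z y; first by rewrite ry contractL contract_neq.
  by rewrite rD // contract_s // contract_neq ?fconnect1.
Qed.

Lemma rotations_fixed A s x : s \in rotations A -> x \notin A -> s x = x.
Proof.
move=> /rotationsP sA Ax; apply/esym/eqP.
by rewrite -(same_fiber_notin (s x) Ax) -sA fconnect1.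
Qed.

Lemma rotationsP_at A s x :
  reflect ((forall y, y != x -> fconnect s x y = same_fiber A x y) /\
           {in predC1 x &, fconnect s =2 same_fiber A})
          (s \in rotations A).
Proof.
apply: (iffP (rotationsP A s)) => [sA | [sx sNx] y z].
  by split=> [y _ | y z _ _]; apply: sA.
have [-> | yx] := eqVneq y x; have [-> | zx] := eqVneq z x.
- by rewrite connect0 /same_fiber eqxx.
- exact: sx.
- by rewrite (fconnect_sym perm_inj) same_fiberC sx.
- exact: sNx.
Qed.

Lemma rotations_insert A s x y :
    x \notin A -> y \in fiber A (f x) ->
  ((tperm y x * s)%g \in rotations (x |: A)) && ((tperm y x * s)%g y == x) =
  (s \in rotations A).
Proof.
move=> Ax fib_y.
have yx : y != x by apply: contraNneq Ax => <-; case/setIdP: fib_y.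
rewrite permM tpermL; have [sx | s'x] := eqVneq (s x) x; last first.
  rewrite andbF; apply/esym/negP => sA.
  by rewrite (rotations_fixed sA Ax) eqxx in s'x.
have off : {in predC1 x &, fconnect (tperm y x * s)%g =2 fconnect s}.
  by move=> z t zx tx; rewrite fconnect_insert // !contract_neq.
rewrite andbT.
apply/(rotationsP_at _ _ x)/(rotationsP_at _ _ x) => -[_ sAx]; split.
- by move=> z zx; rewrite fconnect_fixed // same_fiber_notin // eq_sym.
- by move=> z t zx tx; rewrite -off // sAx // same_fiber_setU1.
- move=> z zx; rewrite fconnect_insert // contractL contract_neq //.
  rewrite sAx // same_fiber_setU1l //.
  case/setIdP: fib_y => Ay /eqP fyx; rewrite !inE /same_fiber Ay fyx.
  by rewrite [_ == f z]eq_sym; case: eqVneq => // <-; rewrite Ay fyx eqxx.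
- by move=> z t zx tx; rewrite off // sAx // same_fiber_setU1.
Qed.

Lemma rotations_setU1_isolated A x : x \notin A ->
  fiber A (f x) = set0 -> rotations (x |: A) = rotations A.
Proof.
move=> Ax fib0.
have same_x y : y != x -> same_fiber (x |: A) x y = same_fiber A x y.
  move=> yx; rewrite same_fiber_setU1l // fib0 inE same_fiber_notin //.
  by rewrite eq_sym (negPf yx).
apply/setP => s; apply/(rotationsP_at _ _ x)/(rotationsP_at _ _ x) => -[sx sNx];
  split=> [y yx | y z yx zx].
- by rewrite sx ?same_x.
- by rewrite sNx // same_fiber_setU1.
- by rewrite sx ?same_x.
- by rewrite sNx // same_fiber_setU1.
Qed.

Lemma rotations_pred_fiber A s x : x \notin A -> fiber A (f x) != set0 ->
  s \in rotations (x |: A) -> s^-1%g x \in fiber A (f x).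
Proof.
move=> Ax /set0Pn[y fib_y] /rotationsP sA.
have [s'x | s'x] := eqVneq (s^-1%g x) x.
  have sx : s x = x by rewrite -{1}s'x permKV.
  have yx : y != x by apply: contraNneq Ax => <-; case/setIdP: fib_y.
  by rewrite -same_fiber_setU1l // -sA fconnect_fixed //= (negPf yx) in fib_y.
rewrite -same_fiber_setU1l // -sA (fconnect_sym perm_inj).
by rewrite -{2}[x](permKV s) fconnect1.
Qed.

Lemma card_rotations_setU1 A x : x \notin A ->
  #|rotations (x |: A)| = maxn 1 #|fiber A (f x)| * #|rotations A|.
Proof.
move=> Ax; have [fib0 | fib] := eqVneq (fiber A (f x)) set0.
  by rewrite rotations_setU1_isolated // fib0 cards0 mul1n.
rewrite (maxn_idPr _) ?card_gt0 // -sum_nat_const -sum1_card.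
rewrite (partition_big (fun s : {perm T} => s^-1%g x) [in fiber A (f x)]) /=.
  apply: eq_bigr => y fib_y.
  rewrite -sum1_card (reindex_inj (mulgI (tperm y x))) /=.
  apply: eq_bigl => s; rewrite -(rotations_insert s Ax fib_y).
  by rewrite (canF_eq (permKV _)) [_ == x]eq_sym.
by move=> s; apply: rotations_pred_fiber.
Qed.

Lemma rotations0 : rotations set0 = [set 1%g].
Proof.
apply/setP => s; rewrite in_set1; apply/idP/eqP => [s0 | ->].
  by apply/permP => x; rewrite perm1 (rotations_fixed s0) ?inE.
apply/rotationsP => x y.
by rewrite fconnect_fixed ?perm1 // /same_fiber in_set0 orbF [RHS]eq_sym.
Qed.

Lemma card_fiber_setU1 A x u : x \notin A ->
  #|fiber (x |: A) u| = (f x == u) + #|fiber A u|.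
Proof.
move=> Ax; rewrite (cardsD1 x) !inE eqxx; congr (_ + _); apply: eq_card => y.
by rewrite !inE; have [-> | _] := eqVneq y x; rewrite ?(negPf Ax).
Qed.

Lemma card_rotations A : #|rotations A| = \prod_u (#|fiber A u|.-1)`!.
Proof.
have [k] := ubnP #|A|; elim: k A => // k IHk A.
have [-> _ | [x Ax]] := set_0Vmem A.
  rewrite rotations0 cards1 big1 // => u _.
  by rewrite (_ : fiber _ _ = set0) ?cards0 //; apply/setP => x; rewrite !inE.
rewrite (cardsD1 x) Ax ltnS => /IHk cardA'; rewrite -(setD1K Ax).
have: x \notin A :\ x by rewrite setD11.
move: (A :\ x) cardA' => B cardB Bx; rewrite card_rotations_setU1 // cardB.
rewrite (bigD1 (f x)) //= [RHS](bigD1 (f x)) //= mulnA; congr (_ * _).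
  rewrite card_fiber_setU1 // eqxx.
  by case: #|_| => // c; rewrite (maxn_idPr _).
by apply: eq_bigr => u /negPf ux; rewrite card_fiber_setU1 // eq_sym ux.
Qed.

End Rotations.

Section Trees.
Variables (n m : nat).
Local Notation vertex := ('I_n + 'I_m)%type.
Local Notation edge := ('I_n * 'I_m)%type.
Implicit Types (x y z : vertex) (e f : edge) (E : {set edge}).
Implicit Types (d : vertex -> nat).

Definition white x := if x is inl _ then true else false.

Definition incident x e :=
  match x with inl i => e.1 == i | inr j => e.2 == j end.

Definition other_end x e : vertex :=
  if x is inl _ then inr e.2 else inl e.1.

Definition degree E x := #|[set e in E | incident x e]|.

Lemma incident_endE x e z :
  incident x e -> incident z e = (z == x) || (z == other_end x e).
Proof.
by case: x z => [i|j] [k|l] /= /eqP xe; rewrite /eq_op /= -?xe ?orbF eq_sym.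
Qed.

Lemma incident_other_end x e : incident (other_end x e) e.
Proof. by case: x => v /=. Qed.

Lemma other_endK x e : incident x e -> other_end (other_end x e) e = x.
Proof. by case: x => v /= /eqP ->. Qed.

Lemma other_end_neq x e : other_end x e != x.
Proof. by case: x. Qed.

Lemma degree_setU1 E e x :
  e \notin E -> degree (e |: E) x = incident x e + degree E x.
Proof. by case: x => v; apply: card_fiber_setU1. Qed.

Lemma degree_gt0 E e x : e \in E -> incident x e -> 0 < degree E x.
Proof. by move=> Ee xe; apply/card_gt0P; exists e; rewrite inE Ee. Qed.

Lemma btree_adjP E x y :
  reflect (exists2 e, e \in E & incident x e /\ y = other_end x e)
          (btree_adj E x y).
Proof.
apply: (iffP idP) => [|[[a b] Ee []]].
  by case: x y => [i|j] [k|l] //= Ee; [exists (i, l) | exists (k, j)].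
by case: x => [i|j] /= /eqP <- -> /=.
Qed.

Lemma btree_adj_connect_sym E : connect_sym (btree_adj E).
Proof. by apply: sym_connect_sym => -[i|j] [k|l]. Qed.

Lemma connect_degree0 E x y :
  degree E x = 0 -> connect (btree_adj E) x y = (x == y).
Proof.
move=> dx0; apply/idP/eqP => [/connectP[[|z p] //=]|->]; last exact: connect0.
by case/andP=> /btree_adjP[e Ee [/(degree_gt0 Ee)]]; rewrite dx0.
Qed.

Lemma connect_add_leaf E x e : incident x e -> degree E x = 0 ->
  let h := contract x (other_end x e) in
  forall y z,
    connect (btree_adj (e |: E)) y z = connect (btree_adj E) (h y) (h z).
Proof.
move=> xe dx0 h; apply: connect_retract => [|y z|z|y z].
- exact: btree_adj_connect_sym.
- case/btree_adjP=> f Ef [yf ->]; apply/connect1/btree_adjP.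
  by exists f; rewrite // !inE Ef orbT.
- rewrite /h; have [-> | zx] := eqVneq z x; last by rewrite contract_neq.
  by rewrite contractL; apply/connect1/btree_adjP; exists e; rewrite ?setU11.
case/btree_adjP=> f /setU1P[-> | Ef] [yf ->].
  move: yf; rewrite (incident_endE _ xe) /h => /orP[]/eqP ->;
    by rewrite ?other_endK // contractL contract_neq ?other_end_neq.
have end_neq u : incident u f -> u != x.
  by move=> uf; apply: contraTneq (degree_gt0 Ef uf) => ->; rewrite dx0.
rewrite /h !contract_neq ?end_neq ?incident_other_end //.
by apply/connect1/btree_adjP; exists f.
Qed.

(* The support of [d] is the vertex set of these trees, so that a leaf can be
   deleted without changing the ambient type of vertices. *)
Definition trees_with_degrees d : {set {set edge}} :=
  [set E : {set edge} | [forall x, degree E x == d x] &&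
     [forall x, forall y,
        (0 < d x) && (0 < d y) ==> connect (btree_adj E) x y]].

Lemma trees_with_degreesP d E :
  reflect ((forall x, degree E x = d x) /\
           (forall x y, 0 < d x -> 0 < d y -> connect (btree_adj E) x y))
          (E \in trees_with_degrees d).
Proof.
rewrite inE; apply: (iffP andP) => -[dE cE]; split.
- by move=> x; apply/eqP/(forallP dE).
- by move=> x y dx dy; apply: (implyP (forallP (forallP cE x) y)); rewrite dx.
- by apply/forallP=> x; rewrite dE.
- by apply/'forall_'forall_implyP => x y /andP[]; apply: cE.
Qed.

Lemma trees_with_degrees_edge d e :
    d =1 (fun z => nat_of_bool (incident z e)) ->
  trees_with_degrees d = [set [set e]].
Proof.
move=> dE; apply/setP => E; rewrite in_set1.
apply/trees_with_degreesP/eqP => [[degE _]|->].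
  have sub_e f : f \in E -> f = e.
    move=> Ef; have := degree_gt0 (x := inl f.1) Ef (eqxx _).
    have := degree_gt0 (x := inr f.2) Ef (eqxx _).
    rewrite !degE !dE !lt0b /= => /eqP e2 /eqP e1.
    by case: e f e1 e2 {dE Ef} => a b [c g] /= -> ->.
  apply/setP => f; rewrite in_set1; apply/idP/eqP => [/sub_e //|->].
  have: 0 < degree E (inl e.1) by rewrite degE dE /= eqxx.
  by case/card_gt0P => g /setIdP[Eg _]; rewrite -(sub_e g Eg).
split=> [x|x y]; last first.
  rewrite !dE !lt0b => xe; rewrite (incident_endE _ xe) => /orP[]/eqP ->.
    exact: connect0.
  by apply/connect1/btree_adjP; exists e; rewrite ?set11.
rewrite -[[set e]]setU0 degree_setU1 ?inE // dE -[RHS]addn0; congr (_ + _).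
by apply/eqP; rewrite cards_eq0; apply/eqP/setP => f; rewrite !inE.
Qed.

Definition drop_edge d e : vertex -> nat := fun z => d z - incident z e.

Definition plane_weight d := \prod_x (d x).-1`!.

Definition support_size d b := \sum_(x | white x == b) (0 < d x).

Lemma sum_by_color (F : vertex -> nat) :
  \sum_(b : bool) \sum_(x | white x == b) F x = \sum_x F x.
Proof. by rewrite [RHS](partition_big white xpredT). Qed.

Lemma sum_color (F : vertex -> nat) b :
  \sum_(x | white x == b) F x =
  if b then \sum_i F (inl i) else \sum_j F (inr j).
Proof. by rewrite big_sumType; case: b; rewrite /= big_pred0_eq ?addn0. Qed.

Lemma sum_incident_color e b : \sum_(z | white z == b) incident z e = 1.
Proof.
rewrite sum_color; case: b; rewrite -big_mkcond sum1_card.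
  by rewrite -[RHS](card1 e.1); apply: eq_card => i; rewrite !inE eq_sym.
by rewrite -[RHS](card1 e.2); apply: eq_card => j; rewrite !inE eq_sym.
Qed.

Lemma sum_degree_color E b : \sum_(x | white x == b) degree E x = #|E|.
Proof.
transitivity (\sum_(x | white x == b) \sum_(e in E) incident x e).
  apply: eq_bigr => x _; rewrite -big_mkcondr /= sum1_card.
  by apply: eq_card => e; rewrite !inE.
rewrite exchange_big /= -sum1_card; apply: eq_bigr => e _.
exact: sum_incident_color.
Qed.

Lemma sum_other_end x (F : vertex -> nat) :
  \sum_(e | incident x e) F (other_end x e) =
  \sum_(z | white z == ~~ white x) F z.
Proof.
rewrite [RHS]big_sumType /=; case: x => [i|j] /=.
  under eq_bigl do rewrite -[_ == _]andbT.
  rewrite -(pair_big (fun k => k == i) xpredT (fun k l => F (inr l))) /=.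
  by rewrite big_pred1_eq big_pred0_eq.
rewrite (eq_bigl (fun e : edge => true && (e.2 == j))) //.
rewrite -(pair_big xpredT (fun l => l == j) (fun k l => F (inl k))) /=.
by rewrite big_pred0_eq addn0; apply: eq_bigr => k _; apply: big_pred1_eq.
Qed.

Section Leaf.
Variables (d : vertex -> nat) (x : vertex) (e : edge).
Hypotheses (dx : d x = 1) (xe : incident x e).
Local Notation y := (other_end x e).

Lemma drop_edgeK z : 0 < d y -> drop_edge d e z + incident z e = d z.
Proof.
move=> dy; rewrite subnK // (incident_endE _ xe).
by have [-> | _] := eqVneq z x; [rewrite dx | have [-> | _] := eqVneq].
Qed.

Lemma drop_edge_gt0 z :
  1 < d y -> (0 < drop_edge d e z) = (0 < d z) && (z != x).
Proof.
move=> dy; rewrite /drop_edge (incident_endE _ xe).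
have [-> | _] := eqVneq z x; first by rewrite dx.
by have [-> | _] := eqVneq z y; rewrite andbT ?subn0 // subn_gt0 dy ltnW.
Qed.

Lemma trees_with_degrees_add_leaf E : e \notin E -> 1 < d y ->
  (e |: E \in trees_with_degrees d) =
  (E \in trees_with_degrees (drop_edge d e)).
Proof.
move=> eE dy; have degE : (forall z, degree (e |: E) z = d z) <->
                          (forall z, degree E z = drop_edge d e z).
  split=> dE z; first by rewrite /drop_edge -dE degree_setU1 // addKn.
  by rewrite degree_setU1 // dE addnC drop_edgeK // ltnW.
have deg0 : (forall z, degree E z = drop_edge d e z) -> degree E x = 0.
  by move->; rewrite /drop_edge dx xe.
have supp_contract u : 0 < d u -> 0 < drop_edge d e (contract x y u).
  move=> du; rewrite drop_edge_gt0 // /contract.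
  by have [_ | ->] := eqVneq u x; rewrite ?du // other_end_neq ltnW.
apply/trees_with_degreesP/trees_with_degreesP => -[dE cE].
  have dropE := degE.1 dE; split=> // u v.
  rewrite !drop_edge_gt0 // => /andP[du ux] /andP[dv vx].
  by have := cE u v du dv; rewrite (connect_add_leaf xe) ?deg0 // !contract_neq.
split=> [|u v du dv]; first exact/degE.
by rewrite (connect_add_leaf xe) ?deg0 //; apply: cE; apply: supp_contract.
Qed.

Lemma trees_with_degrees_no_isolated_edge E :
    2 < \sum_z (0 < d z) -> d y <= 1 ->
  E \in trees_with_degrees d -> e \notin E.
Proof.
move=> supp_d dy /trees_with_degreesP[dE cE]; apply/negP => Ee.
have eE' : e \notin E :\ e by rewrite setD11.
rewrite -(setD1K Ee) in dE cE; move: (E :\ e) dE cE eE' => B dB cB eB.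
have deg_end z : incident z e -> d z <= 1 -> degree B z = 0.
  by move=> ze; rewrite -dB degree_setU1 // ze; case: degree.
have degBx : degree B x = 0 by rewrite deg_end ?dx.
have degBy : degree B y = 0 by rewrite deg_end ?incident_other_end.
have card_ends : \sum_z ((z == x) + (z == y)) = 2.
  by rewrite big_split /= -!big_mkcond /= !sum1_card !card1.
move: supp_d; rewrite ltnNge -card_ends => /negP[].
apply: leq_sum => z _; have [// | dz] := posnP (d z).
have := cB x z; rewrite dx => /(_ isT dz).
rewrite (connect_add_leaf xe) // contractL connect_degree0 // eq_sym.
by rewrite /contract; case: (eqVneq z x) => // _ ->.
Qed.

Lemma card_trees_with_leaf_edge : 2 < \sum_z (0 < d z) ->
  #|[set E in trees_with_degrees d | e \in E]| =
  (1 < d y) * #|trees_with_degrees (drop_edge d e)|.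
Proof.
move=> supp_d; have [dy | dy] := ltnP 1 (d y); last first.
  apply/eqP; rewrite cards_eq0; apply/eqP/setP => E; rewrite in_set0 inE.
  apply/negP => /andP[tE].
  exact/negP/(trees_with_degrees_no_isolated_edge supp_d dy tE).
have eN E : E \in trees_with_degrees (drop_edge d e) -> e \notin E.
  move=> /trees_with_degreesP[dE _]; apply/negP => /degree_gt0/(_ xe).
  by rewrite dE /drop_edge dx xe.
have -> : [set E in trees_with_degrees d | e \in E] =
          [set e |: B | B in trees_with_degrees (drop_edge d e)].
  apply/setP => E; apply/setIdP/imsetP => [[tE Ee]|[B tB ->]].
    exists (E :\ e); last by rewrite setD1K.
    by rewrite -trees_with_degrees_add_leaf ?setD11 // setD1K.
  by rewrite setU11 trees_with_degrees_add_leaf ?eN.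
rewrite mul1n card_in_imset // => B C /eN eB /eN eC eqBC.
by rewrite -(setU1K eB) eqBC setU1K.
Qed.

Lemma plane_weight_drop_edge : 1 < d y ->
  plane_weight d = (d y).-1 * plane_weight (drop_edge d e).
Proof.
move=> dy; rewrite /plane_weight (bigD1 y) //= [in RHS](bigD1 y) //= mulnA.
congr (_ * _).
  rewrite /drop_edge incident_other_end.
  by case: (d y) dy => [|[|k]] //= _; rewrite subn1 factS.
apply: eq_bigr => z /negPf zy; rewrite /drop_edge (incident_endE _ xe) zy orbF.
by have [-> | _] := eqVneq z x; [rewrite dx | rewrite subn0].
Qed.

Lemma sum_drop_edge b : 0 < d y ->
  \sum_(z | white z == b) drop_edge d e z = (\sum_(z | white z == b) d z).-1.
Proof.
move=> dy; rewrite -[in RHS](eq_bigr _ (fun z _ => drop_edgeK z dy)).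
by rewrite big_split /= sum_incident_color addn1.
Qed.

Lemma sum_support_drop_edge (P : pred vertex) : 1 < d y ->
  \sum_(z | P z) (0 < d z) = P x + \sum_(z | P z) (0 < drop_edge d e z).
Proof.
move=> dy; pose F z := (z == x) + (0 < drop_edge d e z).
rewrite [LHS](eq_bigr F) => [|z _]; last first.
  rewrite /F drop_edge_gt0 //.
  by have [-> | _] := eqVneq z x; rewrite ?dx ?andbT.
rewrite big_split; congr (_ + _).
rewrite big_mkcond (bigD1 x) //= eqxx big1 ?addn0.
  by case: (P x).
by move=> z /negPf ->; case: ifP.
Qed.

End Leaf.

Lemma weighted_trees_leaf_rec d x :
    d x = 1 -> 2 < \sum_z (0 < d z) ->
  #|trees_with_degrees d| * plane_weight d =
  \sum_(e | incident x e) (d (other_end x e)).-1 *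
     (#|trees_with_degrees (drop_edge d e)| * plane_weight (drop_edge d e)).
Proof.
move=> dx supp_d.
have -> : #|trees_with_degrees d| =
    \sum_(e | incident x e) #|[set E in trees_with_degrees d | e \in E]|.
  rewrite -sum1_card (eq_bigr (fun E => \sum_(e | incident x e) (e \in E))).
    rewrite exchange_big /=; apply: eq_bigr => e _.
    by rewrite -big_mkcondr /= -sum1_card; apply: eq_bigl => E; rewrite inE.
  move=> E /trees_with_degreesP[degE _]; rewrite -dx -degE -big_mkcondr /=.
  by rewrite sum1_card; apply: eq_card => e; rewrite !inE andbC.
rewrite big_distrl; apply: eq_bigr => e xe /=.
rewrite (card_trees_with_leaf_edge dx xe) //.
have [dy | dy] := ltnP 1 (d (other_end x e)); last first.
  by rewrite (_ : _.-1 = 0) //; lia.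
by rewrite (plane_weight_drop_edge dx xe) // mul1n mulnCA.
Qed.

(* [N] is the number of edges, each having one end of either colour. *)
Definition tree_degrees N d :=
  (forall b, \sum_(x | white x == b) d x = N) /\ \sum_x (0 < d x) = N.+1.

Lemma tree_degrees_has_leaf N d : tree_degrees N d -> exists x, d x = 1.
Proof.
case=> sum_d supp_d; apply/exists_eqP; apply: contraT => /existsPn no1.
have: \sum_x (0 < d x) * 2 <= \sum_x d x.
  by apply: leq_sum => x _; case: (d x) (no1 x) => [|[|k]].
by rewrite -big_distrl /= supp_d -sum_by_color big_bool /= !sum_d; lia.
Qed.

Lemma tree_degrees_drop_edge N d x e :
    d x = 1 -> incident x e ->
    1 < d (other_end x e) -> tree_degrees N.+1 d ->
  tree_degrees N (drop_edge d e).
Proof.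
move=> dx xe dy [sum_d supp_d]; split=> [b|].
  by rewrite (sum_drop_edge dx xe) ?sum_d // ltnW.
by apply: succn_inj; rewrite -supp_d (sum_support_drop_edge dx xe xpredT dy).
Qed.

Lemma support_size_le N d b : tree_degrees N d -> support_size d b <= N.
Proof.
by case=> sum_d _; rewrite -(sum_d b) leq_sum // => z _; case: (d z).
Qed.

Lemma support_sizeD N d b :
  tree_degrees N d -> support_size d b + support_size d (~~ b) = N.+1.
Proof. by case=> _ <-; rewrite -sum_by_color (big_bool_negb _ _ b). Qed.

Lemma sum_pred_degree N d b : tree_degrees N d ->
  \sum_(z | white z == ~~ b) (d z).-1 = (support_size d b).-1.
Proof.
move=> Td; have := support_sizeD b Td; have [sum_d _] := Td.
have: \sum_(z | white z == ~~ b) ((d z).-1 + (0 < d z)) = N.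
  rewrite -(sum_d (~~ b)); apply: eq_bigr => z _.
  by case: (d z) => // k; apply: addn1.
by rewrite big_split /= -/(support_size d (~~ b)); lia.
Qed.

Lemma support_size_leaf_gt1 N d x :
  d x = 1 -> tree_degrees N.+2 d -> 1 < support_size d (white x).
Proof.
move=> dx [sum_d _]; have := sum_d (white x).
rewrite /support_size (bigD1 x) // [in _ < _](bigD1 x) //= dx.
rewrite !add1n ltnS lt0n => -[].
apply: contra_eq_neq => /eqP; rewrite sum_nat_eq0 => /forall_inP supp0.
by rewrite big1 // => z /supp0; case: (d z).
Qed.

Lemma card_trees_with_degrees_edge d : tree_degrees 1 d ->
  #|trees_with_degrees d| * plane_weight d = 1.
Proof.
case=> sum_d _.
have sole b : exists2 x, white x = b & forall z, white z = b -> d z = (x == z).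
  have /eqP/sum_nat_eq1[x [/eqP xb dx dz]] := sum_d b; exists x => // z zb.
  by have [<- // | xz] := eqVneq x z; rewrite dz ?zb // eq_sym.
have [[i|//] _ di] := sole true; have [[//|j] _ dj] := sole false.
have dE : d =1 (fun z => nat_of_bool (incident z (i, j))).
  by case=> [k|l]; [apply: di | apply: dj].
rewrite (trees_with_degrees_edge dE) cards1 mul1n /plane_weight.
by rewrite big1 // => z _; rewrite dE; case: incident.
Qed.

Lemma card_trees_with_degrees N d : tree_degrees N.+1 d ->
  #|trees_with_degrees d| * plane_weight d =
  \prod_(b : bool) (support_size d b).-1`!.
Proof.
elim: N d => [|N IHN] d Td.
  rewrite card_trees_with_degrees_edge // big1 // => b _.
  by case: support_size (support_size_le b Td) => [|[]].
have [x dx] := tree_degrees_has_leaf Td; pose s := support_size d.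
have s_gt1 : 1 < s (white x) := support_size_leaf_gt1 dx Td.
rewrite (weighted_trees_leaf_rec dx) ?(proj2 Td) //.
rewrite (eq_bigr (fun e => (d (other_end x e)).-1 *
                   ((s (white x)).-2`! * (s (~~ white x)).-1`!))).
  rewrite -big_distrl (sum_other_end x (fun z => (d z).-1)).
  rewrite (sum_pred_degree _ Td).
  rewrite (big_bool_negb _ _ (white x)) /= mulnA -/s; congr (_ * _).
  by case: (s _) s_gt1 => [|[|k]].
move=> e xe; have [dy | dy] := ltnP 1 (d (other_end x e)); last first.
  by rewrite (_ : _.-1 = 0) //; lia.
congr (_ * _); rewrite IHN; last exact: tree_degrees_drop_edge dx xe dy Td.
rewrite (big_bool_negb _ _ (white x)) /s /support_size.
by rewrite !(sum_support_drop_edge dx xe _ dy) eqxx; case: (white x).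
Qed.

End Trees.

Section PlaneTrees.
Variables (n m : nat).
Implicit Types (E : {set 'I_n * 'I_m}).

Lemma is_rotationE (T : finType) (side : 'I_n * 'I_m -> T) E s :
  is_rotation side E s = (s \in rotations side E).
Proof.
apply/idP/idP => [|sE].
  case/andP=> /andP[/forall_inP fixE /forall_inP stabE] /'forall_forallP connE.
  apply/rotationsP => e e'; rewrite /same_fiber.
  have [Ee | eE] := boolP (e \in E); last first.
    by rewrite fconnect_fixed ?orbF 1?eq_sym //; apply/eqP/fixE.
  rewrite /=; apply/idP/orP => [/iter_findex <- | [/eqP -> // | sEe]].
    right; elim: (findex _ _ _) => [|k /andP[Ek /eqP ->]] /=.
      by rewrite Ee eqxx.
    by have /andP[-> /eqP ->] := stabE _ Ek; rewrite eqxx.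
  by apply: (implyP (connE e e')); rewrite Ee.
have /rotationsP sameE := sE.
apply/andP; split; first (apply/andP; split).
- by apply/forall_inP => e Ee; apply/eqP; apply: rotations_fixed sE Ee.
- apply/forall_inP => e Ee; have := fconnect1 s e.
  by rewrite sameE => /orP[/eqP <-|/and3P[_ -> /eqP ->]]; rewrite ?Ee eqxx.
- apply/'forall_forallP => e e'; apply/implyP => sEe.
  by rewrite sameE /same_fiber sEe orbT.
Qed.

Lemma card_plane_lbtree :
  #|[pred t | @plane_lbtree n m t]| =
  \sum_(E : {set 'I_n * 'I_m} | is_btree E) plane_weight (degree E).
Proof.
transitivity (\sum_(E : {set 'I_n * 'I_m} | is_btree E)
                #|setX (rotations fst E) (rotations snd E)|).
  under eq_bigr do rewrite -sum1_card.
  rewrite pair_big_dep /= -sum1_card.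
  pose reassoc
    (u : {set 'I_n * 'I_m} * ({perm 'I_n * 'I_m} * {perm 'I_n * 'I_m})) :=
      (u.1, u.2.1, u.2.2).
  rewrite (reindex reassoc) /=.
    by apply: eq_bigl => -[E [s r]]; rewrite in_setX -!is_rotationE.
  by exists (fun t => (t.1.1, (t.1.2, t.2))) => [[E [s r]]|[[E s] r]].
apply: eq_bigr => E _.
by rewrite cardsX !card_rotations /plane_weight big_sumType.
Qed.

Lemma support_size_full (d : 'I_n + 'I_m -> nat) b :
  (forall x, 0 < d x) -> support_size d b = if b then n else m.
Proof.
move=> d_gt0; rewrite /support_size; under eq_bigr do rewrite d_gt0.
by rewrite sum_color; case: b; rewrite sum1_card card_ord.
Qed.

End PlaneTrees.

Section DegreeSequences.
Variables (n m : nat).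
Local Notation vertex := ('I_n.+1 + 'I_m.+1)%type.
Implicit Types (E : {set 'I_n.+1 * 'I_m.+1}) (x : vertex).

Local Notation excess_pair := (n.+1.-tuple 'I_m.+1 * m.+1.-tuple 'I_n.+1)%type.

Definition excesses : {set excess_pair} :=
  setX [set p : n.+1.-tuple 'I_m.+1 | \sum_(i <- p) i == m]
       [set q : m.+1.-tuple 'I_n.+1 | \sum_(j <- q) j == n].

Definition degrees (t : excess_pair) x : nat :=
  match x with inl i => (tnth t.1 i).+1 | inr j => (tnth t.2 j).+1 end.

(* In a tree the numbers [degree - 1] over the white vertices add up to [m], and
   those over the black vertices to [n], so [inord] never truncates here. *)
Definition excess E : excess_pair :=
  ([tuple inord (degree E (inl i)).-1 | i < n.+1],
   [tuple inord (degree E (inr j)).-1 | j < m.+1]).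

Lemma degrees_gt0 t x : 0 < degrees t x.
Proof. by case: x. Qed.

Lemma card_excesses : #|excesses| = 'C(n + m, n) * 'C(m + n, m).
Proof. by rewrite cardsX !card_ord_partitions. Qed.

Lemma tree_degrees_full (d : vertex -> nat) :
    (forall x, 0 < d x) ->
    (forall b, \sum_(x | white x == b) d x = (n + m).+1) ->
  tree_degrees (n + m).+1 d.
Proof.
move=> d_gt0 sum_d; split=> //; rewrite -sum_by_color big_bool /=.
by rewrite -!/(support_size d _) !support_size_full // addnS.
Qed.

Lemma btree_degree_gt0 E x : is_btree E -> 0 < degree E x.
Proof.
case/andP=> /'forall_forallP connE _; rewrite lt0n; apply/eqP => dx0.
have [y xy] : exists y, x != y.
  by case: x {dx0} => [i|j]; [exists (inr ord0) | exists (inl ord0)].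
by have := connE x y; rewrite connect_degree0 // (negPf xy).
Qed.

Lemma btree_tree_degrees E : is_btree E -> tree_degrees (n + m).+1 (degree E).
Proof.
move=> tE; apply: tree_degrees_full => [x|b]; first exact: btree_degree_gt0.
by case/andP: tE => _ /eqP cardE; rewrite sum_degree_color cardE addSn addnS.
Qed.

Lemma sum_excess_btree E b :
  is_btree E -> \sum_(x | white x == b) (degree E x).-1 = if b then m else n.
Proof.
move=> /[dup] tE /btree_tree_degrees/(sum_pred_degree (~~ b)).
rewrite negbK => ->.
by rewrite support_size_full => [|x]; [case: b | apply: btree_degree_gt0].
Qed.

Lemma degrees_excess E : is_btree E -> degrees (excess E) =1 degree E.
Proof.
move=> tE x; have: (degree E x).-1 <= if white x then m else n.
  by rewrite -(sum_excess_btree _ tE) (bigD1 x) //= leq_addr.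
have := btree_degree_gt0 x tE.
by case: x => v d_gt0 d_le /=; rewrite tnth_mktuple inordK ?ltnS // prednK.
Qed.

Lemma excess_btree E : is_btree E -> excess E \in excesses.
Proof.
move=> tE; rewrite !inE !big_tuple; apply/andP; split; apply/eqP.
  rewrite -[RHS](sum_excess_btree true tE) sum_color.
  by apply: eq_bigr => i _; rewrite -(degrees_excess tE).
rewrite -[RHS](sum_excess_btree false tE) sum_color.
by apply: eq_bigr => j _; rewrite -(degrees_excess tE).
Qed.

Lemma tree_degrees_excesses t :
  t \in excesses -> tree_degrees (n + m).+1 (degrees t).
Proof.
rewrite !inE !big_tuple => /andP[/eqP sum1 /eqP sum2].
apply: tree_degrees_full => [x|b]; first exact: degrees_gt0.
by rewrite sum_color; case: b => /=; under eq_bigr do rewrite -addn1;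
  rewrite big_split sum1_card card_ord /= ?sum1 ?sum2; lia.
Qed.

Lemma btree_with_excess t E : t \in excesses ->
  is_btree E && (excess E == t) = (E \in trees_with_degrees (degrees t)).
Proof.
move=> ex_t; apply/andP/trees_with_degreesP => [[tE /eqP <-]|[dE connE]].
  split=> [x|x y _ _]; first by rewrite degrees_excess.
  by case/andP: tE => /'forall_forallP.
split.
  apply/andP; split.
    by apply/'forall_forallP => x y; rewrite connE ?degrees_gt0.
  have [sum_t _] := tree_degrees_excesses ex_t.
  rewrite -(sum_degree_color E true) (eq_bigr _ (fun x _ => dE x)) sum_t.
  by rewrite addSn addnS.
case: t dE {connE ex_t} => p q dE; apply/eqP; congr (_, _);
  by apply: eq_from_tnth => v; rewrite tnth_mktuple dE inord_val.
Qed.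

Lemma card_trees_with_excess t : t \in excesses ->
  #|trees_with_degrees (degrees t)| * plane_weight (degrees t) = n`! * m`!.
Proof.
move/tree_degrees_excesses/card_trees_with_degrees ->; rewrite big_bool.
by rewrite !support_size_full // => x; apply: degrees_gt0.
Qed.

End DegreeSequences.

Theorem theorem2p1 (n m : nat) (hn : 0 < n) (hm : 0 < m) :
  #|[pred t | @plane_lbtree n m t]| * ((n.-1)`! * (m.-1)`!) = ((n + m - 2)`!) ^ 2.
Proof.
case: n m hn hm => [//|n] [//|m] _ _; rewrite addSn addnS subn2 /=.
rewrite card_plane_lbtree.
rewrite (partition_big (@excess n m) [in excesses n m]) /= => [|E]; last first.
  exact: excess_btree.
rewrite (eq_bigr (fun=> n`! * m`!)) => [|t ex_t].
  rewrite sum_nat_const card_excesses -mulnA mulnACA bin_fact_add.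
  by rewrite (mulnC n`!) bin_fact_add addnC mulnn.
rewrite -(card_trees_with_excess ex_t) -sum_nat_const.
apply: eq_big => [E|E /andP[tE /eqP <-]]; first exact: btree_with_excess.
by apply: eq_bigr => x _; rewrite degrees_excess.
Qed.
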